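(* Let $R$ be an equivalence relation on a finite set $U=\{x_1,\dots,x_n\}$ and let $B(R)$ be the matrix representation of $R$. Then the set $\mathcal{B}(M(R))$ of bases of the matroid $M(R)$ satisfies $$\mathcal{B}(M(R))=\mathrm{Min}\big(\{\theta(\mathbf{v}):\mathbf{v}\in I_{GF(2)}(B(R))\}\big).$$
   Context: Let $U/R=\{P_1,\dots,P_s\}$ be the set of equivalence classes of $R$. $\mathcal{C}(R)$ denotes the family of all two-element subsets $\{x,y\}\subseteq U$ ($x\neq y$) such that $\{x,y\}\subseteq P_i$ for some $i$. $M(R)$ denotes the unique matroid on $U$ whose set of circuits is $\mathcal{C}(R)$ (it is known that such a matroid exists). Bases are inclusion-maximal independent sets. The matrix representation of $R$ is $B(R)=(b_{ij})_{s\times n}$ with $b_{ij}=1$ if $x_j\in P_i$ and $b_{ij}=0$ otherwise, regarded here as a matrix over the two-element field $GF(2)$, with $j$-th column labeled by $x_j$. For an $m\times n$ matrix $A$ over a field $F$, $I_F(A)=\{\mathbf{x}\in F^n: A\mathbf{x}=\mathbf{1}\}$, where $\mathbf{1}\in F^m$ is the all-ones vector. The support of $\mathbf{v}=(v_1,\dots,v_n)^T\in F^n$ is $\theta(\mathbf{v})=\{x_i\in U: v_i\neq 0\}$. For a family $\mathcal{S}$ of subsets of $U$, $\mathrm{Min}(\mathcal{S})$ is the family of inclusion-minimal members of $\mathcal{S}$. *)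

(* Defs.v *)
From mathcomp Require Import all_boot all_order all_algebra.

Set Implicit Arguments.
Unset Strict Implicit.
Unset Printing Implicit Defensive.

Import GRing.Theory.

Definition Min (U : finType) (S : {set {set U}}) : {set {set U}} :=
  [set A | minset (fun B => B \in S) A].

Definition Max (U : finType) (S : {set {set U}}) : {set {set U}} :=
  [set A | maxset (fun B => B \in S) A].

Record matroid (U : finType) := Matroid {
  indep : {set {set U}};
  indep_set0 : set0 \in indep;
  indep_sub : forall A B : {set U}, A \subset B -> B \in indep -> A \in indep;
  indep_aug : forall A B : {set U}, A \in indep -> B \in indep -> #|A| < #|B| ->
    exists2 b, b \in B :\: A & b |: A \in indep }.

Definition bases (U : finType) (M : matroid U) : {set {set U}} := Max (indep M).

Definition circuits (U : finType) (M : matroid U) : {set {set U}} :=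
  Min (~: indep M).

Definition classes_of (U : finType) (R : rel U) : {set {set U}} :=
  equivalence_partition R [set: U].

Definition class_pairs (U : finType) (R : rel U) : {set {set U}} :=
  [set C : {set U} | (#|C| == 2) && [exists P in classes_of R, C \subset P]].

(* Row i is labelled by the class P i and column j by the point x j, for
   arbitrary enumerations P of the classes and x of the points. *)
Definition repr_mx (F : fieldType) (U : finType) (s n : nat)
    (P : 'I_s -> {set U}) (x : 'I_n -> U) : 'M[F]_(s, n) :=
  \matrix_(i, j) ((x j \in P i)%:R)%R.

Definition ones_solutions (F : fieldType) (m n : nat) (A : 'M[F]_(m, n)) :
    pred 'cV[F]_n :=
  [pred v | (A *m v == const_mx 1)%R].

(* theta(v), the k-th coordinate of v being labelled by x_k. *)
Definition theta (F : fieldType) (U : finType) (n : nat) (x : 'I_n -> U)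
    (v : 'cV[F]_n) : {set U} :=
  [set x k | k : 'I_n & (v k 0 != 0)%R].

Lemma indepP (U : finType) (M : matroid U) (A : {set U}) :
  reflect (forall C, C \in circuits M -> ~~ (C \subset A)) (A \in indep M).
Proof.
apply: (iffP idP) => [iA C | noC].
  rewrite inE => /minsetP[]; rewrite inE => dC _.
  by apply: contra dC => /indep_sub; apply.
apply: contraT => dA.
have [|C minC sCA] := @minset_exists _ (fun B => B \in ~: indep M) A.
  by rewrite inE.
by move: (noC C); rewrite inE => /(_ minC); rewrite sCA.
Qed.

(* Together with class_matroid_exists below: for an equivalence relation R there
   is one and only one matroid whose circuits are class_pairs R. *)
Lemma circuits_inj (U : finType) (M N : matroid U) :
  circuits M = circuits N -> indep M = indep N.
Proof.
move=> eqC; apply/setP => A.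
by apply/indepP/indepP; rewrite eqC.
Qed.

Section Existence.
Variables (U : finType) (R : rel U) (eqR : equivalence_rel R).

Definition class_indep : {set {set U}} :=
  [set A : {set U} | [forall C in class_pairs R, ~~ (C \subset A)]].

Lemma class_pairsP (C : {set U}) :
  reflect (exists x y, [/\ x != y, R x y & C = [set x; y]])
          (C \in class_pairs R).
Proof.
have Rrefl z : R z z by case: (eqR z z z).
rewrite inE; apply: (iffP andP) => [[/cards2P[x [y [nxy ->]]]] |].
  move=> /exists_inP[P /imsetP[z _ ->] /subsetP sP].
  exists x, y; split => //.
  have := sP x; have := sP y; rewrite !inE !eqxx orbT => /(_ isT) zy /(_ isT).
  by case: (eqR z x y) => _ /[apply] <-.
case=> x [y [nxy Rxy ->]]; split; first by rewrite cards2 nxy.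
apply/exists_inP; exists [set z in [set: U] | R x z]; first exact: imset_f.
by apply/subsetP => z; rewrite !inE => /orP[] /eqP ->; rewrite ?Rrefl ?Rxy.
Qed.

Lemma class_indepP (A : {set U}) :
  reflect {in A &, forall x y, R x y -> x = y} (A \in class_indep).
Proof.
rewrite inE; apply: (iffP forall_inP) => [noC x y xA yA Rxy | injA C].
  apply/eqP; apply: contraT => nxy.
  have /negP[] := noC [set x; y] (introT (class_pairsP _)
    (ex_intro _ x (ex_intro _ y (And3 nxy Rxy erefl)))).
  by rewrite subUset !sub1set xA.
case/class_pairsP => x [y [nxy Rxy ->]]; rewrite subUset !sub1set.
by apply: contra nxy => /andP[xA yA]; apply/eqP/injA.
Qed.

Lemma class_matroid_exists : exists M : matroid U, circuits M = class_pairs R.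
Proof.
have Rrefl z : R z z by case: (eqR z z z).
have Rsym x y : R x y = R y x.
  by apply/idP/idP => r; [case: (eqR x y x) | case: (eqR y x y)] => _ /(_ r) <-.
have H0 : set0 \in class_indep by apply/class_indepP => x; rewrite inE.
have HS (A B : {set U}) : A \subset B -> B \in class_indep -> A \in class_indep.
  move=> /subsetP sAB /class_indepP iB; apply/class_indepP => x y /sAB xB /sAB.
  exact: iB.
have HA (A B : {set U}) : A \in class_indep -> B \in class_indep ->
    #|A| < #|B| -> exists2 b, b \in B :\: A & b |: A \in class_indep.
  move=> /class_indepP iA /class_indepP iB ltAB.
  pose c x := [set y | R x y].
  have cE x y : c x = c y -> R x y by move/setP/(_ y); rewrite !inE Rrefl.
  have : ~~ (c @: B \subset c @: A).
    apply/negP => /subset_leq_card; rewrite card_in_imset.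
      by rewrite leqNgt (leq_ltn_trans (leq_imset_card _ _) ltAB).
    by move=> x y xB yB /cE; apply: iB.
  case/subsetPn => _ /imsetP[b bB ->] ncb.
  have nR a : a \in A -> ~~ R b a.
    move=> aA; apply: contra ncb => Rba; apply/imsetP; exists a => //.
    by apply/setP => z; rewrite !inE; case: (eqR b a z) => _ /(_ Rba).
  exists b; first by rewrite inE bB andbT; apply/negP => /nR; rewrite Rrefl.
  apply/class_indepP => x y; rewrite !inE.
  move=> /orP[/eqP->|xA] /orP[/eqP->|yA] //.
  - by rewrite (negbTE (nR _ yA)).
  - by rewrite Rsym (negbTE (nR _ xA)).
  exact: iA.
have depP (D : {set U}) :
    reflect (exists2 E, E \in class_pairs R & E \subset D) (D \in ~: class_indep).
  rewrite in_setC inE negb_forall_in.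
  by apply: (iffP exists_inP) => -[E pE sED]; exists E => //; rewrite negbK in sED *.
exists (Matroid H0 HS HA); apply/setP => C; rewrite inE /=.
apply/minsetP/idP => [[/depP[D pD sDC] minC] | pC].
  by rewrite -(minC D) //; apply/depP; exists D.
split; first by apply/depP; exists C.
move=> D /depP[E pE sED] sDC; apply/eqP; rewrite eqEcard sDC.
apply: leq_trans (subset_leq_card sED).
by move: pC pE; rewrite !inE => /andP[/eqP-> _] /andP[/eqP-> _].
Qed.

End Existence.

(* Main.v *)
Require Import Defs.
From mathcomp Require Import all_boot all_order all_algebra.

(** For a partition of [U], three families of subsets coincide: the maximal sets
    meeting every block in at most one point (the bases of [M(R)]), the
    transversals, and the minimal sets meeting every block in an odd number of
    points. For the last, deleting two points of one block preserves all
    parities. Over GF(2) a vector is the indicator of its support, and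
    [B(R) v = 1] says that the support meets every class in an odd number of
    points. *)

Set Implicit Arguments.
Unset Strict Implicit.
Unset Printing Implicit Defensive.

Section Blocks.
Variables (U : finType) (Q : {set {set U}}).
Implicit Types A B C D : {set U}.

Lemma block_exists (partQ : partition Q [set: U]) (a : U) :
  exists2 B, B \in Q & a \in B.
Proof.
exists (pblock Q a); last by rewrite mem_pblock (cover_partition partQ) inE.
by rewrite pblock_mem // (cover_partition partQ) inE.
Qed.

(** If [A] misses a block, any point of that block can be added without affecting the other blocks,
    since blocks are disjoint. *)
Lemma Max_card_le1 (partQ : partition Q [set: U]) A :
  (A \in Max [set A | [forall B in Q, #|A :&: B| <= 1]])
    = [forall B in Q, #|A :&: B| == 1].
Proof.
have [_ trivQ Q0] := and3P partQ.
rewrite inE; apply/maxsetP/forall_inP; rewrite inE.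
  case=> /forall_inP leA maxA B QB; rewrite eqn_leq leA //=.
  apply: contraT; rewrite -eqn0Ngt cards_eq0 => /eqP AB0.
  have /set0Pn[b bB] : B != set0 by apply: contraNneq Q0 => <-.
  have nbA : b \notin A by apply/negP => bA; have := in_set0 b; rewrite -AB0 inE bA bB.
  case/negP: nbA; rewrite -(maxA (b |: A)) ?subsetUr ?setU11 // inE.
  apply/forall_inP => C QC; have [<-|nBC] := eqVneq B C.
    by rewrite setIUl AB0 setU0 (leq_trans (subset_leq_card (subsetIl _ _))) ?cards1.
  apply: leq_trans (leA C QC); apply/subset_leq_card/subsetP => z.
  rewrite !inE => /andP[/orP[/eqP->|->] zC //].
  by have /disjointFr/(_ bB) := trivIsetP trivQ B C QB QC nBC; rewrite zC.
move=> eqA; split; first by apply/forall_inP => B /eqA/eqP->.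
move=> D; rewrite inE => /forall_inP leD sAD; apply/eqP.
rewrite eqEsubset sAD andbT; apply/subsetP => d dD.
have [B QB dB] := block_exists partQ d.
(* [D] has room for one point in the block [B] of [d], and [A] already supplies it. *)
have : A :&: B == D :&: B by rewrite eqEcard setSI // (eqP (eqA B QB)) leD.
by move/eqP/setP/(_ d); rewrite !inE dD dB !andbT.
Qed.

Lemma Min_card_odd (partQ : partition Q [set: U]) A :
  (A \in Min [set A | [forall B in Q, odd #|A :&: B|]])
    = [forall B in Q, #|A :&: B| == 1].
Proof.
have [_ trivQ _] := and3P partQ.
rewrite inE; apply/minsetP/forall_inP; rewrite inE.
  case=> /forall_inP oddA minA B QB; rewrite eqn_leq odd_gt0 ?oddA // andbT.
  rewrite leqNgt; apply/negP => /card_gt1P[a [b []]].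
  rewrite !inE => /andP[aA aB] /andP[bA bB] nab.
  (* Minimality would force [A] without [a] and [b] to equal [A], although [a] has been removed. *)
  have := setD11 a (A :\ b); rewrite setDDl.
  suff -> : A :\: ([set b] :|: [set a]) = A by rewrite aA.
  apply: minA; last exact: subsetDl.
  rewrite inE; apply/forall_inP => C QC; have := oddA C QC.
  (* The removal takes two points from [C] when [C] is [B] and none otherwise, so no parity
     changes. *)
  rewrite -(cardsID [set b; a]) oddD setIDAC.
  suff -> : odd #|A :&: C :&: [set b; a]| = false by [].
  have [<-|nBC] := eqVneq B C.
    rewrite (setIidPr _) ?cards2 1?eq_sym ?nab //.
    by rewrite subUset !sub1set !inE aA bA aB bB.
  have dBC : [disjoint B & C] by apply: (trivIsetP trivQ).
  suff -> : A :&: C :&: [set b; a] = set0 by rewrite cards0.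
  apply/setP => z; rewrite !inE; apply/negP => /andP[/andP[_ zC]].
  by case/orP=> /eqP zE; move: zC; rewrite zE (disjointFr dBC).
move=> eqA; split; first by apply/forall_inP => B /eqA/eqP->.
move=> D; rewrite inE => /forall_inP oddD sDA; apply/eqP.
rewrite eqEsubset sDA; apply/subsetP => a aA.
have [B QB aB] := block_exists partQ a.
(* An odd intersection is nonempty, so [D] keeps the only point of [A] in [B]. *)
have : D :&: B == A :&: B.
  by rewrite eqEcard setSI // (eqP (eqA B QB)) odd_gt0 ?oddD.
by move/eqP/setP/(_ a); rewrite !inE aA aB !andbT.
Qed.

End Blocks.

(** A set is independent iff it contains no circuit, and the circuits here are the pairs lying in
    one class. *)
Lemma indep_card_le1 (U : finType) (R : rel U) (M : matroid U) :
  circuits M = class_pairs R ->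
  indep M = [set A | [forall B in classes_of R, #|A :&: B| <= 1]].
Proof.
move=> eqC; apply/setP => A; rewrite inE.
apply/indepP/forall_inP; rewrite eqC => indA.
  move=> B QB; rewrite leqNgt; apply/negP => /card_gt1P[a [b []]].
  rewrite !inE => /andP[aA aB] /andP[bA bB] nab.
  have /indA/negP[] : [set a; b] \in class_pairs R.
    rewrite inE cards2 nab /=; apply/exists_inP; exists B => //.
    by rewrite subUset !sub1set aB.
  by rewrite subUset !sub1set aA.
move=> C; rewrite inE => /andP[/eqP C2 /exists_inP[B QB sCB]].
apply/negP => sCA; have := indA B QB; rewrite leqNgt -C2 => /negP[].
by rewrite subset_leq_card // subsetI sCA.
Qed.

Section Solutions.
Import GRing.Theory.
Local Open Scope ring_scope.

(** Specific to GF(2): a vector is recovered from its support. *)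
Lemma F2_indicator (c : 'F_2) : c = (c != 0)%:R.
Proof. by case: c => -[|[|]] // i; apply: val_inj. Qed.

Lemma F2_nat_eq1 (m : nat) : (m%:R == 1 :> 'F_2) = odd m.
Proof. by rewrite -val_eqE /= val_Fp_nat // modn2; case: odd. Qed.

Variables (U : finType) (n : nat) (x : 'I_n -> U) (x_bij : bijective x).

Lemma in_theta (F : fieldType) (v : 'cV[F]_n) (k : 'I_n) :
  (x k \in theta x v) = (v k 0 != 0).
Proof. by rewrite mem_imset ?inE //; apply: bij_inj. Qed.

Lemma theta_indicator (F : fieldType) (A : {set U}) :
  theta x (\col_k ((x k \in A)%:R : F)) = A.
Proof.
have [y _ yK] := x_bij; apply/setP => u; rewrite -(yK u) in_theta mxE.
by case: (_ \in A); rewrite ?oner_eq0 ?eqxx.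
Qed.

Lemma ones_solutionsE (s : nat) (P : 'I_s -> {set U}) (v : 'cV['F_2]_n) :
  (v \in ones_solutions (repr_mx 'F_2 P x))
    = [forall i, odd #|theta x v :&: P i|].
Proof.
(* Row [i] of the product counts, modulo 2, the support points in [P i]; the bijection [x] turns the
   sum over points into one over columns. *)
have mulE i : (repr_mx 'F_2 P x *m v) i 0 = #|theta x v :&: P i|%:R.
  rewrite mxE -sum1_card natr_sum (reindex x) /=; last exact: onW_bij.
  rewrite [RHS]big_mkcond /=; apply: eq_bigr => k _.
  rewrite mxE inE in_theta {1}[v k 0]F2_indicator.
  by case: (v k 0 != 0); case: (x k \in P i); rewrite ?mulr1 ?mulr0.
rewrite inE; apply/eqP/forallP => [Av i | oddv].
  by rewrite -F2_nat_eq1 -mulE Av mxE.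
by apply/colP => i; rewrite mulE mxE; apply/eqP; rewrite F2_nat_eq1.
Qed.

Lemma theta_ones_solutions (s : nat) (P : 'I_s -> {set U}) :
  [set theta x v | v in ones_solutions (repr_mx 'F_2 P x)]
    = [set A | [forall B in [set P i | i : 'I_s], odd #|A :&: B|]].
Proof.
apply/setP => A; rewrite inE; apply/imsetP/forall_inP => [[v vS ->] B | oddA].
  by case/imsetP=> i _ ->; move: vS; rewrite ones_solutionsE => /forallP.
(* Every subset of [U] is the support of its own indicator vector. *)
exists (\col_k (x k \in A)%:R); last by rewrite theta_indicator.
rewrite ones_solutionsE theta_indicator; apply/forallP => i.
exact/oddA/imset_f.
Qed.

End Solutions.

Theorem theorem3 (U : finType) (R : rel U) (eqR : equivalence_rel R)
    (n : nat) (x : 'I_n -> U) (x_bij : bijective x)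
    (s : nat) (P : 'I_s -> {set U}) (P_inj : injective P)
    (P_classes : [set P i | i : 'I_s] = classes_of R)
    (M : matroid U) (M_circuits : circuits M = class_pairs R) :
  bases M = Min [set theta x v | v in ones_solutions (repr_mx 'F_2 P x)].
Proof.
have partR : partition (classes_of R) [set: U].
  by apply: equivalence_partitionP => a b c _ _ _; apply: eqR.
apply/setP => A; rewrite theta_ones_solutions // P_classes Min_card_odd //.
by rewrite /bases (indep_card_le1 M_circuits) Max_card_le1.
Qed.
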